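(* Let $P$ be a loop-free and passive program with reachability verification condition $VC$, and let $\mathcal{R}=\{R_0,\dots,R_n\}$ be the set of reachability variables used in $VC$. The Statement Coverage Algorithm, started with the arguments $VC$ and $\mathcal{R}$, terminates and returns a set $TC$ of valuations. For any block in the program $P$ there exists a feasible (complete) path $\pi$ passing this block if and only if there exists a test case $\nu\in TC$ that passes this block. That is, for every $i\in\{0,\dots,n\}$: there is a feasible complete path of $P$ visiting $\mathrm{Block}_i$ if and only if there is $\nu\in TC$ with $\nu\models VC$ and $\nu(R_i)=\mathrm{true}$.
   Context: Programs. A (passive) program consists of finitely many blocks $\mathrm{Block}_0,\dots,\mathrm{Block}_n$. Each $\mathrm{Block}_i$ consists of a (possibly empty) finite sequence of statements $S_i$ followed by a non-deterministic goto to the blocks with indices in a set $Succ_i\subseteq\{0,\dots,n\}$. $\mathrm{Block}_0$ is the unique initial block and $\mathrm{Block}_n$ is the unique final block, i.e. the only block with $Succ_n=\emptyset$. Passive means that all statements have the form $\mathbf{assume}\ E$, where $E$ is a Boolean-sorted first-order expression over the program variables, interpreted in a fixed background structure; no statement changes a variable, so a state is a valuation of all program variables and stays constant during an execution. Loop-free means that the directed graph on $\{0,\dots,n\}$ with edges $i\to j$ for $j\in Succ_i$ is acyclic. Put $Pre_i=\{j : i\in Succ_j\}$. Clones. The loop-free program may have been obtained from a program with loops by finite loop unwinding, which copies blocks. Two blocks are clones of each other if they are copies of the same block of the program before unwinding (a copied block and its original included). Paths. A path is a sequence of blocks in which each block is followed by one of its successors; it is complete if it starts in $\mathrm{Block}_0$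 and ends in $\mathrm{Block}_n$. A path is feasible if there is a valuation of the program variables under which every assumed expression $E$ in every block of the path is true. Weakest liberal precondition. $wlp(\mathbf{assume}\ E, Q) = (E\Rightarrow Q)$ and $wlp(S;T,Q)=wlp(S,wlp(T,Q))$ (and $wlp$ of the empty sequence with respect to $Q$ is $Q$). Reachability verification condition. Introduce fresh Boolean variables $B_0,\dots,B_n$ and $R_0,\dots,R_n$. Let $$WLP:\quad \bigwedge_{0\le i<n}\Bigl(B_i \equiv \neg wlp\bigl(S_i,\bigwedge_{j\in Succ_i}\neg B_j\bigr)\Bigr)\ \wedge\ \bigl(B_n\equiv\neg wlp(S_n,\mathrm{false})\bigr),$$ $$VC:\quad WLP\ \wedge\ (R_0\equiv B_0)\ \wedge\ \bigwedge_{1\le i\le n}\Bigl(R_i\equiv B_i\wedge\bigvee_{j\in Pre_i}R_j\Bigr).$$ $R_i$ is called the reachability variable of $\mathrm{Block}_i$. An empty disjunction is false. A test case for (passing) $\mathrm{Block}_i$ is a valuation $\nu$ with $\nu\models VC$ and $\nu(R_i)=\mathrm{true}$. Oracle. $\mathrm{checksat}(\psi)$ is an oracle which, for every formula $\psi$ it is given, returns some valuation of the free variables satisfying $\psi$ if $\psi$ is satisfiable (over the fixed background structure), and returns the empty set otherwise. Statement Coverage Algorithm (input $VC$, $\mathcal{R}$; the set $\mathcal{R}$ is modified during the run): 1. $TC\leftarrow\emptyset$; $\nu\leftarrow\mathrm{checksat}(VC)$. 2. While $\nu\neq\emptyset$: set $TC\leftarrow TC\cup\{\nu\}$; for each $R_i\in\mathcal{R}$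 with $\nu(R_i)=\mathrm{true}$, remove from $\mathcal{R}$ the variable $R_i$ and, if $\mathrm{Block}_i$ has clones created by loop unwinding, also the reachability variables of all clones of $\mathrm{Block}_i$; let $\phi$ be the enabling clause $\bigvee_{R\in\mathcal{R}}R$ over the remaining set $\mathcal{R}$ (false if $\mathcal{R}$ is empty); set $\nu\leftarrow\mathrm{checksat}(VC\wedge\phi)$. 3. Return $TC$.
   Formalization: The literal equivalence fails for blocks with clones, since a covered block's clones are removed from R. It is proved for blocks without other clones; for all blocks it is proved up to clones, together with the direction from a test case in TC to a feasible complete path. *)

(* Defs.v *)
From mathcomp Require Import all_boot.
From mathcomp Require Import boolp classical_sets.

Set Implicit Arguments.
Unset Strict Implicit.
Unset Printing Implicit Defensive.

Inductive fosort (B : Type) : Type :=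
  | Bool
  | Base of B.
Arguments Bool {B}.

Record signature := Signature {
  bsort : Type;
  func : Type;
  arity : func -> nat;
  dom : forall f : func, 'I_(arity f) -> fosort bsort;
  cod : func -> fosort bsort }.

(* The variables of sort [s] in the scope of a quantifier over [s0]. *)
Inductive bind (B : Type) (X : fosort B -> Type) (s0 : fosort B) :
    fosort B -> Type :=
  | Bound : bind X s0 s0
  | Free s of X s : bind X s0 s.
Arguments Bound {B X s0}.
Arguments Free {B X s0 s}.

(* [X s] is the type of the variables of sort [s]. *)
Inductive expr (Sg : signature) (X : fosort (bsort Sg) -> Type) :
    fosort (bsort Sg) -> Type :=
  | Var s of X s : expr X s
  | App (f : func Sg) of (forall k : 'I_(arity f), expr X (dom k)) :
      expr X (cod f)
  | Eq s of expr X s & expr X s : expr X Bool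
  | TT : expr X Bool
  | FF : expr X Bool
  | Not of expr X Bool : expr X Bool
  | And of expr X Bool & expr X Bool : expr X Bool
  | Or of expr X Bool & expr X Bool : expr X Bool
  | Imp of expr X Bool & expr X Bool : expr X Bool
  | Iff of expr X Bool & expr X Bool : expr X Bool
  | Forall s of expr (bind X s) Bool : expr X Bool
  | Exists s of expr (bind X s) Bool : expr X Bool.
Arguments TT {Sg X}.
Arguments FF {Sg X}.

Definition formula (Sg : signature) (X : fosort (bsort Sg) -> Type) : Type :=
  expr X Bool.

Definition carrier (B : Type) (U : B -> Type) (s : fosort B) : Type :=
  match s with Bool => bool | Base b => U b end.

Record structure (Sg : signature) := Structure {
  univ : bsort Sg -> Type;
  interp : forall f : func Sg,
    (forall k : 'I_(arity f), carrier univ (dom k)) -> carrier univ (cod f) }.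

Definition valuation (Sg : signature) (M : structure Sg)
    (X : fosort (bsort Sg) -> Type) : Type :=
  forall s, X s -> carrier (univ M) s.

Definition bind_val (Sg : signature) (M : structure Sg)
    (X : fosort (bsort Sg) -> Type) (v : valuation M X)
    (s0 : fosort (bsort Sg)) (a : carrier (univ M) s0) :
    valuation M (bind X s0) :=
  fun s x => match x in bind _ _ s return carrier (univ M) s with
             | Bound => a
             | Free _ y => v _ y
             end.

Fixpoint eval (Sg : signature) (M : structure Sg)
    (X : fosort (bsort Sg) -> Type) (s : fosort (bsort Sg)) (e : expr X s) :
    valuation M X -> carrier (univ M) s :=
  match e in expr _ s return valuation M X -> carrier (univ M) s with
  | Var _ x => fun v => v _ x
  | App f args => fun v => interp (fun k => eval (args k) v)
  | Eq _ e1 e2 => fun v => `[< eval e1 v = eval e2 v >]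
  | TT => fun _ => true
  | FF => fun _ => false
  | Not e1 => fun v => ~~ eval e1 v
  | And e1 e2 => fun v => eval e1 v && eval e2 v
  | Or e1 e2 => fun v => eval e1 v || eval e2 v
  | Imp e1 e2 => fun v => eval e1 v ==> eval e2 v
  | Iff e1 e2 => fun v => (eval e1 v : bool) == eval e2 v
  | Forall _ e1 => fun v => `[< forall a, eval e1 (bind_val v a) >]
  | Exists _ e1 => fun v => `[< exists a, eval e1 (bind_val v a) >]
  end.

Definition models (Sg : signature) (M : structure Sg)
    (X : fosort (bsort Sg) -> Type) (v : valuation M X) (psi : formula X) : Prop :=
  eval psi v = true.

Definition bind_map (B : Type) (X Y : fosort B -> Type)
    (r : forall s, X s -> Y s) (s0 s : fosort B) (x : bind X s0 s) :
    bind Y s0 s :=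
  match x in bind _ _ s return bind Y s0 s with
  | Bound => Bound
  | Free _ y => Free (r _ y)
  end.

Fixpoint rename (Sg : signature) (X Y : fosort (bsort Sg) -> Type)
    (r : forall s, X s -> Y s) (s : fosort (bsort Sg)) (e : expr X s) : expr Y s :=
  match e in expr _ s return expr Y s with
  | Var _ x => Var (r _ x)
  | App f args => App (fun k => rename r (args k))
  | Eq _ e1 e2 => Eq (rename r e1) (rename r e2)
  | TT => TT
  | FF => FF
  | Not e1 => Not (rename r e1)
  | And e1 e2 => And (rename r e1) (rename r e2)
  | Or e1 e2 => Or (rename r e1) (rename r e2)
  | Imp e1 e2 => Imp (rename r e1) (rename r e2)
  | Iff e1 e2 => Iff (rename r e1) (rename r e2)
  | Forall _ e1 => Forall (rename (@bind_map _ _ _ r _) e1)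
  | Exists _ e1 => Exists (rename (@bind_map _ _ _ r _) e1)
  end.

Inductive stmt (Sg : signature) (V : fosort (bsort Sg) -> Type) : Type :=
  | Assume of formula V.

(* The blocks are 0, ..., [last_block]; [ord0] is the initial block and
   [ord_max] the final one. *)
Record program (Sg : signature) (V : fosort (bsort Sg) -> Type) := Program {
  last_block : nat;
  body : 'I_last_block.+1 -> seq (stmt V);
  succ : 'I_last_block.+1 -> {set 'I_last_block.+1};
  final_block : forall i, (succ i == finset.set0) = (i == ord_max) }.

Section Programs.
Variables (Sg : signature) (M : structure Sg) (V : fosort (bsort Sg) -> Type).
Variable P : program V.

Definition block : Type := 'I_(last_block P).+1.

Definition edge : rel 'I_(last_block P).+1 := fun i j => j \in succ i.

Definition pre (i : block) : {set 'I_(last_block P).+1} :=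
  [set j : 'I_(last_block P).+1 | i \in succ j]%SET.

Definition loop_free : Prop :=
  forall c : seq 'I_(last_block P).+1, cycle edge c -> c = [::].

Definition complete_path (pi : seq 'I_(last_block P).+1) : bool :=
  if pi is i :: p then [&& i == ord0, path edge i p & last i p == ord_max]
  else false.

Definition passes_block (v : valuation M V) (i : block) : bool :=
  all (fun s => let: Assume E := s in eval E v) (body i).

Definition feasible (pi : seq 'I_(last_block P).+1) : Prop :=
  exists v : valuation M V, all (passes_block v) pi.

Definition feasible_path_through (i : block) : Prop :=
  exists pi, [/\ complete_path pi, feasible pi & i \in pi].

(* The program variables [PV x] and the fresh Boolean variables [B_i] = [BV i]
   and [R_i] = [RV i]. *)
Inductive vc_var : fosort (bsort Sg) -> Type :=
  | PV s of V s : vc_var s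
  | BV of block : vc_var Bool
  | RV of block : vc_var Bool.

Definition Bvar (i : block) : formula vc_var := Var (BV i).
Definition Rvar (i : block) : formula vc_var := Var (RV i).

Definition wlp_stmt (s : stmt V) (Q : formula vc_var) : formula vc_var :=
  let: Assume E := s in Imp (rename PV E) Q.

Definition wlp (S : seq (stmt V)) (Q : formula vc_var) : formula vc_var :=
  foldr wlp_stmt Q S.

Definition WLP : formula vc_var :=
  And (\big[@And Sg vc_var/TT]_(i < (last_block P).+1 | i < last_block P)
         Iff (Bvar i)
             (Not (wlp (body i)
                       (\big[@And Sg vc_var/TT]_(j in succ i) Not (Bvar j)))))
      (Iff (Bvar ord_max) (Not (wlp (body (ord_max : block)) FF))).

Definition VC : formula vc_var :=
  And (And WLP (Iff (Rvar ord0) (Bvar ord0)))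
      (\big[@And Sg vc_var/TT]_(i < (last_block P).+1 | 1 <= i)
         Iff (Rvar i)
             (And (Bvar i) (\big[@Or Sg vc_var/FF]_(j in pre i) Rvar j))).

Definition test_case (nu : valuation M vc_var) (i : block) : Prop :=
  models nu VC /\ nu Bool (RV i) = true.

(* [None] is the answer "unsatisfiable"; a returned valuation is total, i.e. it
   also gives values to the variables not occurring in [psi]. The successive
   queries of the algorithm are pairwise distinct formulas, so a function of
   the query loses no behaviour of a nondeterministic oracle. *)
Definition is_checksat
    (checksat : formula vc_var -> option (valuation M vc_var)) : Prop :=
  forall psi,
    ((exists nu : valuation M vc_var, models nu psi) ->
       exists2 nu, checksat psi = Some nu & models nu psi) /\
    (~ (exists nu : valuation M vc_var, models nu psi) ->
       checksat psi = None).

(* Loop unwinding is recorded by the map [origin] sending a block to the block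
   of the program before unwinding that it is a copy of; it is injective when
   nothing has been copied. A block is its own clone here. *)
Definition clones (origin : block -> nat) (i : block) :
    {set 'I_(last_block P).+1} :=
  [set j : 'I_(last_block P).+1 | origin j == origin i]%SET.

Section Algorithm.
Variable origin : block -> nat.
Variable checksat : formula vc_var -> option (valuation M vc_var).

Definition enabling_clause (R : {set 'I_(last_block P).+1}) : formula vc_var :=
  \big[@Or Sg vc_var/FF]_(i in R) Rvar i.

(* A set of reachability variables is represented by the set of their
   indices. *)
Definition remove_covered (R : {set 'I_(last_block P).+1})
    (nu : valuation M vc_var) : {set 'I_(last_block P).+1} :=
  (R :\: \bigcup_(i in R | nu Bool (RV i)) clones origin i)%SET.

(* [while_loop psi TC R nu TC']: the while loop entered with the values
   [TC], [R], [nu] terminates and [TC'] is returned. *)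
Inductive while_loop (psi : formula vc_var) :
    set (valuation M vc_var) -> {set 'I_(last_block P).+1} ->
    option (valuation M vc_var) -> set (valuation M vc_var) -> Prop :=
  | While_done TC R : while_loop psi TC R None TC
  | While_iter TC R nu TC' :
      let R' := remove_covered R nu in
      while_loop psi (TC `|` [set nu])%classic R'
        (checksat (And psi (enabling_clause R'))) TC' ->
      while_loop psi TC R (Some nu) TC'.

(* The Statement Coverage Algorithm started on [psi] and [R] terminates and
   returns [TC]. *)
Definition statement_coverage (psi : formula vc_var)
    (R : {set 'I_(last_block P).+1}) (TC : set (valuation M vc_var)) : Prop :=
  while_loop psi classical_sets.set0 R (checksat psi) TC.

End Algorithm.

Definition covered (TC : set (valuation M vc_var)) (i : block) : Prop :=
  exists2 nu, TC nu & test_case nu i.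

End Programs.

(* Main.v *)
(* Fix the values [v] of the program variables and keep only the edges between
   blocks whose assumptions hold under [v]. Since the program is loop-free, the
   equations of VC have exactly one solution extending [v]: [B_i] says that the
   final block can be reached from the passable block [i] in this subgraph, and
   [R_i] says moreover that [i] can be reached from the initial block. So the
   blocks having a test case are those on a feasible complete path. Every
   query answered under an enabling clause removes at least one reachability
   variable, and a variable leaves the set only once a clone of its block is
   covered; the last, unsatisfiable query shows that no remaining block has a
   test case. *)

Require Import Defs.
From mathcomp Require Import all_boot.
From mathcomp Require Import boolp classical_sets.

Set Implicit Arguments.
Unset Strict Implicit.
Unset Printing Implicit Defensive.

(** * Evaluation of renamed expressions and of iterated connectives *)

Lemma eval_rename (Sg : signature) (M : structure Sg)
    (X Y : fosort (bsort Sg) -> Type) (r : forall s, X s -> Y s) s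
    (e : expr X s) (v : valuation M Y) :
  eval (rename r e) v = eval e ((fun s x => v s (r s x)) : valuation M X).
Proof.
(* For the quantifiers: renaming under a binder commutes with extending the valuation at the bound
   variable. *)
have bindE (X' Y' : fosort (bsort Sg) -> Type) (r' : forall s, X' s -> Y' s)
    (w : valuation M Y') s0 (a : carrier (univ M) s0) :
    ((fun s x => bind_val w a (bind_map r' x)) : valuation M (bind X' s0)) =
    bind_val ((fun s x => w s (r' s x)) : valuation M X') a.
  by apply: functional_extensionality_dep => t;
    apply: functional_extensionality_dep; case.
elim: e Y r v => //=.
- by move=> {}X f args IH Y r v; congr interp;
    apply: functional_extensionality_dep => k; apply: IH.
- by move=> {}X t e1 IH1 e2 IH2 Y r v; rewrite IH1 IH2.
- by move=> {}X e1 IH1 Y r v; rewrite IH1.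
- by move=> {}X e1 IH1 e2 IH2 Y r v; rewrite IH1 IH2.
- by move=> {}X e1 IH1 e2 IH2 Y r v; rewrite IH1 IH2.
- by move=> {}X e1 IH1 e2 IH2 Y r v; rewrite IH1 IH2.
- by move=> {}X e1 IH1 e2 IH2 Y r v; rewrite IH1 IH2.
- move=> {}X t e1 IH1 Y r v; congr asbool; apply: propext.
  by split=> h a; have := h a; rewrite IH1 bindE.
- move=> {}X t e1 IH1 Y r v; congr asbool; apply: propext.
  by split=> -[a h]; exists a; move: h; rewrite IH1 bindE.
Qed.

Section Eval.
Variables (Sg : signature) (M : structure Sg) (X : fosort (bsort Sg) -> Type).
Variable v : valuation M X.

Lemma eval_bigAnd (I : finType) (Q : pred I) (F : I -> formula X) :
  eval (\big[@And Sg X/TT]_(i | Q i) F i) v = [forall (i | Q i), eval (F i) v].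
Proof.
(* The cast exposes evaluation as a map into [bool], to which [carrier] at [Bool] reduces. *)
by rewrite -big_andE; apply: (big_morph (fun e : formula X => eval e v : bool)).
Qed.

Lemma eval_bigOr (I : finType) (Q : pred I) (F : I -> formula X) :
  eval (\big[@Or Sg X/FF]_(i | Q i) F i) v = [exists (i | Q i), eval (F i) v].
Proof.
by rewrite -big_orE; apply: (big_morph (fun e : formula X => eval e v : bool)).
Qed.

End Eval.

(** * Induction along the edges of a finite acyclic graph *)

Section Acyclic.
Variables (T : finType) (e : rel T).
Hypothesis acyclic : forall c : seq T, cycle e c -> c = [::].

(** A path back would close up with the edge into a nonempty cycle; [belast] drops its last vertex,
    which is [i] again. *)
Lemma acyclic_connect i j : e i j -> ~~ connect e j i.
Proof.
move=> eij; apply/negP => /connectP[p pth lst].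
by have /acyclic : cycle e (i :: belast j p)
  by rewrite /= {2}lst -lastI /= eij.
Qed.

(** Induction on the number of vertices reachable from [i]. It drops along an edge to [j], because
    [i] reaches itself but is not reachable from [j]. *)
Lemma acyclic_succ_ind (Q : T -> Prop) :
  (forall i, (forall j, e i j -> Q j) -> Q i) -> forall i, Q i.
Proof.
move=> step i; have [m] := ubnP #|connect e i|.
elim: m i => // m IH i /ltnSE le_m; apply: step => j eij; apply: IH.
apply: leq_trans le_m; apply/proper_card/properP; split.
  by apply/fintype.subsetP => k; apply: connect_trans (connect1 eij).
by exists i; [apply: connect0 | apply: acyclic_connect].
Qed.

Lemma acyclic_pred_ind (Q : T -> Prop) :
  (forall j, (forall i, e i j -> Q i) -> Q j) -> forall j, Q j.
Proof.
move=> step j; have [m] := ubnP #|[pred i | connect e i j]|.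
elim: m j => // m IH j /ltnSE le_m; apply: step => i eij; apply: IH.
apply: leq_trans le_m; apply/proper_card/properP; split.
  apply/fintype.subsetP => k /[!inE] cki.
  exact: connect_trans cki (connect1 eij).
by exists j; rewrite !inE ?connect0 // acyclic_connect.
Qed.

End Acyclic.

(** * Models of [VC] and feasible complete paths *)

Section Programs.
Variables (Sg : signature) (M : structure Sg) (V : fosort (bsort Sg) -> Type).
Variable P : program V.
Implicit Types (v : valuation M V) (nu : valuation M (vc_var P)) (i : block P).

Definition prog_val nu : valuation M V := fun s x => nu s (PV P x).

Lemma eval_wlp nu i (Q : formula (vc_var P)) :
  eval (wlp (body i) Q) nu = passes_block (prog_val nu) i ==> eval Q nu.
Proof.
rewrite /passes_block; elim: (body i) => [|[E] S IH] //=.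
rewrite eval_rename -[X in _ ==> X]/(eval (wlp S Q) nu : bool) IH.
by rewrite -/(prog_val nu); case: (eval E (prog_val nu) : bool).
Qed.

(** The disjunct [i == ord_max] absorbs the separate equation of the final block, whose
    postcondition is false. *)
Lemma models_VC nu :
  models nu (VC P) <->
  [/\ forall i, nu Bool (BV i) = passes_block (prog_val nu) i &&
        ((i == ord_max) || [exists (j | j \in succ i), nu Bool (BV j)]),
      nu Bool (RV (ord0 : block P)) = nu Bool (BV (ord0 : block P)) &
      forall i, i != ord0 -> nu Bool (RV i) =
        nu Bool (BV i) && [exists (j | edge j i), nu Bool (RV j)]].
Proof.
rewrite /models /VC /WLP /= !eval_bigAnd /=.
rewrite -[X in _ == ~~ X]/(eval (wlp (body (ord_max : block P)) FF) nu : bool).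
rewrite eval_wlp /= implybF negbK.
have inner_eq i : (nu Bool (BV i) ==
      ~~ (eval (wlp (body i) (\big[@And Sg _/TT]_(j in succ i) Not (Bvar j))) nu))
    = (nu Bool (BV i) == passes_block (prog_val nu) i &&
                       [exists (j | j \in succ i), nu Bool (BV j)]).
  by rewrite eval_wlp eval_bigAnd negb_imply negb_forall_in;
    under eq_existsb do rewrite /= negbK.
have pre_eq i : (nu Bool (RV i) == nu Bool (BV i) &&
      eval (\big[@Or Sg _/FF]_(j in pre i) Rvar j) nu)
    = (nu Bool (RV i) == nu Bool (BV i) && [exists (j | edge j i), nu Bool (RV j)]).
  by rewrite eval_bigOr; under eq_existsb do rewrite inE.
have lt_last i : (i < last_block P) = (i != ord_max).
  by rewrite -val_eqE /= ltn_neqAle -ltnS ltn_ord andbT.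
split.
  move=> /andP[/andP[/andP[/forall_inP HB /eqP Hmax] /eqP H0] /forall_inP HR].
  split=> // i.
    have [->|ni] := eqVneq i ord_max; first by rewrite andbT.
    by move: (HB i); rewrite inner_eq lt_last => /(_ ni)/eqP.
  by rewrite -lt0n => i0; move: (HR i i0); rewrite pre_eq => /eqP.
move=> [HB H0 HR]; rewrite HB H0 eqxx orTb !andbT !eqxx !andbT.
apply/andP; split; apply/forall_inP => i.
  by rewrite lt_last inner_eq HB => /negbTE ->.
by rewrite lt0n pre_eq => i0; rewrite HR.
Qed.

(** Testing both ends makes a nonempty path carry the passability of all its blocks. The empty path
    carries none, hence the extra conjunct in [exits]. *)
Definition passing_edge v : rel 'I_(last_block P).+1 :=
  fun i j => [&& edge i j, passes_block v i & passes_block v j].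

Definition exits v i := passes_block v i && connect (passing_edge v) i ord_max.

Definition live v i := exits v i && connect (passing_edge v) ord0 i.

Lemma path_passing v i p : passes_block v i ->
  path (passing_edge v) i p =
  path (@edge _ _ P) i p && all (passes_block v) p.
Proof.
elim: p i => [|j p IH] i //= vi.
rewrite /passing_edge vi /=; case: (passes_block v j) (IH j) => IHj;
  last by rewrite !andbF.
by rewrite IHj // !andbT !andbA.
Qed.

Lemma feasible_path_live i :
  feasible_path_through M i <-> exists v, live v i.
Proof.
split=> [[[|x p]]|[v]]; first by case.
  move=> [/= /and3P[/eqP-> pth /eqP lst] [v /andP[v0 vp]] ip].
  have vi : passes_block v i.
    by apply: (@allP _ _ (ord0 :: p) _ i ip); rewrite /= v0.
  have pthv : path (passing_edge v) ord0 p by rewrite path_passing // pth.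
  exists v; move: {pth vp} lst pthv; case/splitPl: ip => p1 p2 lst1.
  rewrite last_cat cat_path lst1 => lst2 /andP[pth1 pth2].
  rewrite /live /exits vi /=; apply/andP.
  by split; apply/connectP; [exists p2 | exists p1].
move=> /andP[/andP[vi /connectP[p2 pth2 lst2]] /connectP[p1 pth1 lst1]].
(* The initial block is [i] itself when [p1] is empty, and otherwise the source of a passing
   edge. *)
have v0 : passes_block v (ord0 : block P).
  by case: p1 pth1 lst1 => [_ /= <-|j p /andP[/and3P[]]].
have : path (passing_edge v) ord0 (p1 ++ p2) by rewrite cat_path pth1 -lst1.
rewrite path_passing // => /andP[pth vp]; exists (ord0 :: p1 ++ p2); split.
- by rewrite /= pth last_cat -lst1 -lst2 !eqxx.
- by exists v; rewrite /= v0.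
- by rewrite -cat_cons mem_cat lst1 mem_last.
Qed.

(** The equations of [BV] look at successors and those of [RV] at predecessors, hence one induction
    in each direction. Acyclicity keeps true variables from justifying one another around a
    cycle. *)
Lemma live_of_model nu i : loop_free P -> models nu (VC P) ->
  nu Bool (RV i) = true -> live (prog_val nu) i.
Proof.
move=> acyc /models_VC[HB H0 HR].
have exitsB : forall k, nu Bool (BV k) = true -> exits (prog_val nu) k.
  apply: (acyclic_succ_ind acyc) => k IH; rewrite HB => /andP[vk].
  rewrite /exits vk /= => /orP[/eqP->|/exists_inP[j kj /(IH _ kj)/andP[vj]]].
    exact: connect0.
  by apply: connect_trans; apply: connect1; apply/and3P.
move: i; apply: (acyclic_pred_ind acyc) => i IH.
have [->|i0] := eqVneq i ord0.
  by rewrite H0 /live connect0 andbT; apply: exitsB.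
rewrite HR // => /andP[/exitsB ei /exists_inP[j ji /(IH _ ji)/andP[ej cj]]].
rewrite /live ei; apply: connect_trans cj (connect1 _).
by move: ei ej => /andP[vi _] /andP[vj _]; apply/and3P.
Qed.

Definition live_val v : valuation M (vc_var P) :=
  fun s x => match x in vc_var _ s return carrier (univ M) s with
             | PV _ y => v _ y
             | BV i => exits v i
             | RV i => live v i
             end.

(** Each equation decomposes a path: by its first edge for [exits], by its last edge for
    reachability from [ord0]. In the latter case the predecessor exits through [i]. *)
Lemma live_val_VC v : models (live_val v) (VC P).
Proof.
apply/models_VC; split=> [i||i i0] /=.
(* The program part of [live_val v] is [v] by conversion. *)
- rewrite -[prog_val _]/v.
  apply/idP/andP => [/andP[vi /connectP[[|j p] /=]]|[vi]].
  + by move=> _ ->; rewrite eqxx.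
  + move=> /andP[/and3P[ij _ vj] pth lst]; split=> //; apply/orP; right.
    apply/exists_inP; exists j; rewrite // /exits vj.
    by apply/connectP; exists p.
  + rewrite /exits vi => /orP[/eqP->|/exists_inP[j ij /andP[vj]]].
      exact: connect0.
    by apply: connect_trans; apply: connect1; apply/and3P.
- by rewrite /live connect0 andbT.
- rewrite /live; case ei: (exits v i) => //=.
  have /andP[vi exit_i] := ei.
  apply/idP/exists_inP => [/connectP[p]|[j ji /andP[/andP[vj _] cj]]].
    case/lastP: p => [_ /= i0'|p j]; first by rewrite i0' eqxx in i0.
    rewrite rcons_path last_rcons => /andP[pth pe] ij; subst j.
    have /and3P[e1 v1 _] := pe; exists (last ord0 p) => //.
    rewrite /exits v1 /= (connect_trans (connect1 pe)) //=.
    by apply/connectP; exists p.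
  by apply: connect_trans cj _; apply: connect1; apply/and3P.
Qed.

Lemma feasible_path_test_case i : loop_free P ->
  feasible_path_through M i <->
  exists nu : valuation M (vc_var P), test_case nu i.
Proof.
move=> acyc; rewrite feasible_path_live; split=> [[v lv] | [nu [nuVC nuR]]].
  by exists (live_val v); split; first exact: live_val_VC.
by exists (prog_val nu); apply: live_of_model.
Qed.

(** * Termination and coverage of the loop *)

Section Algorithm.
Variables (origin : block P -> nat).
Variable checksat : formula (vc_var P) -> option (valuation M (vc_var P)).
Hypothesis oracle : is_checksat checksat.

Lemma checksatP psi :
  (exists nu, checksat psi = Some nu /\ models nu psi) \/
  (checksat psi = None /\ forall nu, ~ models nu psi).
Proof.
have [sat unsat] := oracle psi.
have [/sat[nu]|nex] := pselect (exists nu, models nu psi).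
  by left; exists nu.
by right; split=> [|nu m]; [apply: unsat | apply: nex; exists nu].
Qed.

(** A block leaves [R] as soon as one of its clones is covered, so coverage can be guaranteed only
    up to clones. *)
Definition clone_covered (TC : set (valuation M (vc_var P))) i :=
  exists2 j, j \in clones origin i & covered TC j.

Lemma removed_clone_covered TC (R : {set 'I_(last_block P).+1}) nu i :
  models nu (VC P) -> TC nu -> i \in R -> i \notin remove_covered origin R nu ->
  clone_covered TC i.
Proof.
move=> nuVC TCnu iR; rewrite !inE iR andbT negbK => /bigcupP[j /andP[_ nuj]].
rewrite inE => /eqP oij; exists j; first by rewrite inE oij.
by exists nu.
Qed.

(** Induction on the size of [R], with [TC] arbitrary since it grows in each round; [subset TC TC']
    preserves the witnesses found earlier. *)
Lemma while_loop_coverage (R : {set 'I_(last_block P).+1}) TC :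
  exists TC', [/\ while_loop origin checksat (VC P) TC R
                    (checksat (And (VC P) (enabling_clause R))) TC',
                  subset TC TC' &
                  forall i nu, i \in R -> test_case nu i -> clone_covered TC' i].
Proof.
have [m] := ubnP #|R|; elim: m R TC => // m IH R TC /ltnSE le_m.
have [[nu [-> nuVCR]]|[-> unsat]] := checksatP (And (VC P) (enabling_clause R)).
  move: nuVCR; rewrite /models /= => /andP[nuVC].
  rewrite eval_bigOr => /exists_inP[k kR nuk].
  (* The enabling clause yields [k], which is its own clone and thus makes [R] shrink strictly. *)
  have k_removed : k \notin remove_covered origin R nu.
    rewrite !inE kR andbT negbK; apply/bigcupP; exists k; rewrite ?inE //.
    by rewrite kR.
  have [|TC' [loop sub cov]] :=
    IH (remove_covered origin R nu) (TC `|` [set nu])%classic.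
    apply: leq_trans le_m; apply/proper_card/properP; split.
      exact: finset.subsetDl.
    by exists k.
  exists TC'; split; first exact: While_iter.
    by move=> x TCx; apply: sub; left.
  move=> i mu iR mui; case: (boolP (i \in remove_covered origin R nu)) => iR'.
    exact: cov mui.
  by apply: removed_clone_covered iR iR' => //; apply: sub; right.
exists TC; split=> // [|i nu iR [nuVC nuR]]; first exact: While_done.
case: (unsat nu); apply/andP; split; first exact: nuVC.
rewrite -[X in is_true X]/(eval (enabling_clause R) nu) eval_bigOr.
by apply/exists_inP; exists i.
Qed.

(** The first query has no enabling clause, so its answer may remove nothing from the full set; this
    round is therefore treated outside the induction on [R]. *)
Lemma statement_coverage_complete :
  exists TC, statement_coverage origin checksat (VC P) finset.setT TC /\
    forall i nu, test_case nu i -> clone_covered TC i.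
Proof.
rewrite /statement_coverage.
have [[nu [-> nuVC]]|[-> unsat]] := checksatP (VC P); last first.
  exists classical_sets.set0; split; first exact: While_done.
  by move=> i nu [/unsat].
set R := remove_covered origin finset.setT nu.
have [TC [loop sub cov]] :=
  while_loop_coverage R (classical_sets.set0 `|` [set nu])%classic.
exists TC; split; first exact: While_iter.
move=> i mu mui; case: (boolP (i \in R)) => iR; first exact: cov mui.
apply: (removed_clone_covered nuVC _ _ iR); last by rewrite inE.
by apply: sub; right.
Qed.

End Algorithm.
End Programs.

Theorem theorem5 (Sg : signature) (M : structure Sg)
    (V : fosort (bsort Sg) -> Type) (P : program V) (origin : block P -> nat)
    (checksat : formula (vc_var P) -> option (valuation M (vc_var P))) :
  loop_free P -> is_checksat checksat ->
  exists TC : set (valuation M (vc_var P)),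
    statement_coverage origin checksat (VC P) finset.setT TC /\
    (* blocks without other clones, in particular all blocks of a program
       that is not the result of loop unwinding *)
    (forall i : block P, clones origin i = finset.set1 i ->
       feasible_path_through M i <-> covered TC i) /\
    (* any block, up to clones *)
    (forall i : block P,
       (exists2 j, j \in clones origin i & feasible_path_through M j) <->
       (exists2 j, j \in clones origin i & covered TC j)) /\
    (forall i : block P, covered TC i -> feasible_path_through M i).
Proof.
move=> acyc oracle.
have [TC [cov all_cov]] := statement_coverage_complete origin oracle.
have sound i : covered TC i -> feasible_path_through M i.
  by move=> [nu _ nui]; apply/feasible_path_test_case => //; exists nu.
have complete i : feasible_path_through M i -> clone_covered origin TC i.
  by move=> /feasible_path_test_case => /(_ acyc)[nu]; apply: all_cov.
exists TC; split=> //; split; [|split=> //].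
  move=> i clone1; split; last exact: sound.
  by move=> /complete[j]; rewrite clone1 inE => /eqP->.
move=> i; split=> -[j cij].
  move: cij; rewrite inE => /eqP oj /complete[k].
  by rewrite inE oj => oki covk; exists k; rewrite ?inE.
by move=> /sound fj; exists j.
Qed.
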